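(* Let $\mathbf{P}$ be a discrete polymatroid on the ground set $[n]$ with set of bases $B$, let $K$ be a field, and assume that $B$ satisfies the left-sided or the right-sided strong symmetric exchange property. Then: (a) $B$ is sortable, and the sorting relations $x_{\mathbf u}x_{\mathbf v}-x_{\mathbf u'}x_{\mathbf v'}$, where $(\mathbf u,\mathbf v)$ ranges over $B\times B$ and $(\mathbf u',\mathbf v')=\mathrm{sort}(\mathbf u,\mathbf v)$, form a Gröbner basis of $I_B$ with respect to some monomial order; (b) the ideal $I_B$ is generated by the symmetric exchange relations.
   Context: $[n]=\{1,\dots,n\}$; $\boldsymbol\epsilon_1,\dots,\boldsymbol\epsilon_n$ is the canonical basis of $\mathbb Z^n$; $\mathbf u(i)$ or $u_i$ is the $i$th entry of $\mathbf u$; $|\mathbf u|=\sum_i u_i$; $\mathbb Z_+$ is the set of non-negative integers, and $\mathbb Z_+^n$ is ordered componentwise. A discrete polymatroid on $[n]$ is a nonempty finite set $\mathbf P\subseteq\mathbb Z_+^n$ such that (D1) if $\mathbf u\in\mathbf P$, $\mathbf v\in\mathbb Z_+^n$, $\mathbf v\le\mathbf u$, then $\mathbf v\in\mathbf P$; (D2) if $\mathbf u,\mathbf v\in\mathbf P$ with $|\mathbf u|<|\mathbf v|$, there is $i$ with $u_i<v_i$ and $\mathbf u+\boldsymbol\epsilon_i\in\mathbf P$. Its bases are its maximal elements; all bases have the same modulus $d$, the rank of $\mathbf P$. $B$ satisfies the left-sided strong symmetric exchange property if for all $\mathbf u,\mathbf v\in B$ and all $i$ with $\mathbf u(i)>\mathbf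 v(i)$ and $\mathbf u(1)+\cdots+\mathbf u(i-1)<\mathbf v(1)+\cdots+\mathbf v(i-1)$ there exists $j\le i-1$ such that $\mathbf u(j)<\mathbf v(j)$ and both $\mathbf u-\boldsymbol\epsilon_i+\boldsymbol\epsilon_j$ and $\mathbf v+\boldsymbol\epsilon_i-\boldsymbol\epsilon_j$ belong to $B$. The right-sided property is the analogue: for all $\mathbf u,\mathbf v\in B$ and $i$ with $\mathbf u(i)>\mathbf v(i)$ and $\mathbf u(i+1)+\cdots+\mathbf u(n)<\mathbf v(i+1)+\cdots+\mathbf v(n)$ there exists $j\ge i+1$ such that $\mathbf u(j)<\mathbf v(j)$ and both $\mathbf u-\boldsymbol\epsilon_i+\boldsymbol\epsilon_j$ and $\mathbf v+\boldsymbol\epsilon_i-\boldsymbol\epsilon_j$ belong to $B$. Let $T=K[x_{\mathbf u}:\mathbf u\in B]$ and let $I_B$ be the kernel of the $K$-algebra homomorphism $T\to K[t_1,\dots,t_n]$, $x_{\mathbf u}\mapsto \mathbf t^{\mathbf u}=t_1^{u_1}\cdots t_n^{u_n}$. A symmetric exchange relation is an element $x_{\mathbf u}x_{\mathbf v}-x_{\mathbf u-\boldsymbol\epsilon_i+\boldsymbol\epsilon_j}x_{\mathbf v+\boldsymbol\epsilon_i-\boldsymbol\epsilon_j}$ with $\mathbf u,\mathbf v\in B$, $u_i>v_i$, $u_j<v_j$, and $\mathbf u-\boldsymbol\epsilon_i+\boldsymbol\epsilon_j,\ \mathbf v+\boldsymbol\epsilon_i-\boldsymbol\epsilon_j\in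 B$. Sorting: for $\mathbf u,\mathbf v\in B$ write $\mathbf t^{\mathbf u}\mathbf t^{\mathbf v}=t_{i_1}t_{i_2}\cdots t_{i_{2d}}$ with $i_1\le i_2\le\cdots\le i_{2d}$, and let $\mathbf u',\mathbf v'$ be defined by $\mathbf t^{\mathbf u'}=t_{i_1}t_{i_3}\cdots t_{i_{2d-1}}$, $\mathbf t^{\mathbf v'}=t_{i_2}t_{i_4}\cdots t_{i_{2d}}$; set $\mathrm{sort}(\mathbf u,\mathbf v)=(\mathbf u',\mathbf v')$. $B$ is sortable if $\mathrm{sort}(\mathbf u,\mathbf v)\in B\times B$ for all $(\mathbf u,\mathbf v)\in B\times B$.
   Formalization: The discrete polymatroid P = {0} (rank 0) is excluded: there B = {0}, I_B = (x_0 − 1), while all sorting and symmetric exchange relations vanish, so the Gröbner basis claim in (a) and claim (b) fail. *)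

(* Defs.v *)
From mathcomp Require Import all_boot all_order all_algebra.
From mathcomp Require Import finmap.
From mathcomp.multinomials Require Import mpoly.

Set Implicit Arguments.
Unset Strict Implicit.
Unset Printing Implicit Defensive.

Import GRing.Theory.

Local Open Scope ring_scope.

(* Vectors of Z_+^n are the multinomials 'X_{1..n}: (u <= v)%MM is the        *)
(* componentwise order, U_(i) the canonical basis vector, mdeg u the modulus  *)
(* and 'X_[u] the monomial t^u.  The ground set {1, ..., n} is 'I_n.          *)

Definition discrete_polymatroid n (P : {fset 'X_{1..n}}) : Prop :=
  [/\ P != fset0,
      forall u v : 'X_{1..n}, u \in P -> (v <= u)%MM -> v \in P
    & forall u v : 'X_{1..n}, u \in P -> v \in P -> (mdeg u < mdeg v)%N ->
        exists i : 'I_n, (u i < v i)%N /\ (u + U_(i))%MM \in P].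

Definition bases n (P : {fset 'X_{1..n}}) : {fset 'X_{1..n}} :=
  [fset u in P | [forall v : P, (u <= val v)%MM ==> (val v == u)]]%fset.

(* Subtraction of multinomials is truncated; in the exchanges below U_(k) is  *)
(* only ever subtracted from a vector whose k-th entry is positive.           *)

Definition left_strong_exchange n (B : {fset 'X_{1..n}}) : Prop :=
  forall (u v : 'X_{1..n}) (i : 'I_n), u \in B -> v \in B ->
    (v i < u i)%N ->
    (\sum_(k < n | k < i) u k < \sum_(k < n | k < i) v k)%N ->
    exists j : 'I_n, [/\ (j < i)%N, (u j < v j)%N,
      (u - U_(i) + U_(j))%MM \in B & (v + U_(i) - U_(j))%MM \in B].

Definition right_strong_exchange n (B : {fset 'X_{1..n}}) : Prop :=
  forall (u v : 'X_{1..n}) (i : 'I_n), u \in B -> v \in B ->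
    (v i < u i)%N ->
    (\sum_(k < n | i < k) u k < \sum_(k < n | i < k) v k)%N ->
    exists j : 'I_n, [/\ (i < j)%N, (u j < v j)%N,
      (u - U_(i) + U_(j))%MM \in B & (v + U_(i) - U_(j))%MM \in B].

(* The indices i_1 <= i_2 <= ... of the factorization t^w = t_{i_1} t_{i_2} ...,
   in weakly increasing order because enum 'I_n is increasing. *)
Definition mnm_word n (w : 'X_{1..n}) : seq 'I_n :=
  flatten [seq nseq (w i) i | i <- enum 'I_n].

Definition word_mnm n (s : seq 'I_n) : 'X_{1..n} :=
  [multinom count_mem i s | i < n].

Fixpoint every_other (A : Type) (s : seq A) : seq A :=
  match s with
  | x :: _ :: s' => x :: every_other s'
  | _ => s
  end.

Definition sort_pair n (u v : 'X_{1..n}) : 'X_{1..n} * 'X_{1..n} :=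
  let s := mnm_word (u + v)%MM in
  (word_mnm (every_other s), word_mnm (every_other (behead s))).

Definition sortable n (B : {fset 'X_{1..n}}) : Prop :=
  forall u v : 'X_{1..n}, u \in B -> v \in B ->
    (sort_pair u v).1 \in B /\ (sort_pair u v).2 \in B.

(* T = K[x_u : u in B], the variables being numbered along enum B. *)
Definition base_ring (K : fieldType) n (B : {fset 'X_{1..n}}) :=
  {mpoly K[#|{: B}|]}.

Definition xvar (K : fieldType) n (B : {fset 'X_{1..n}}) (u : B) :
    base_ring K B := 'X_(enum_rank u).

Definition toric_map (K : fieldType) n (B : {fset 'X_{1..n}})
    (f : base_ring K B) : {mpoly K[n]} :=
  f \mPo [tuple 'X_[val (enum_val i : B)] | i < #|{: B}|].

Definition toric_ideal (K : fieldType) n (B : {fset 'X_{1..n}})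
    (f : base_ring K B) : Prop := toric_map f = 0.

Definition sym_exchange_relation (K : fieldType) n (B : {fset 'X_{1..n}})
    (f : base_ring K B) : Prop :=
  exists (u v u' v' : B) (i j : 'I_n),
    [/\ ((val v : 'X_{1..n}) i < (val u : 'X_{1..n}) i)%N,
        ((val u : 'X_{1..n}) j < (val v : 'X_{1..n}) j)%N,
        val u' = (val u - U_(i) + U_(j))%MM,
        val v' = (val v + U_(i) - U_(j))%MM
      & f = xvar K u * xvar K v - xvar K u' * xvar K v'].

Definition sorting_relation (K : fieldType) n (B : {fset 'X_{1..n}})
    (f : base_ring K B) : Prop :=
  exists u v u' v' : B,
    sort_pair (val u) (val v) = (val u', val v') /\
    f = xvar K u * xvar K v - xvar K u' * xvar K v'.

Definition ideal_span (A : comNzRingType) (S : A -> Prop) (f : A) : Prop :=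
  exists s : seq (A * A),
    (forall p, p \in s -> S p.2) /\ f = \sum_(p <- s) p.1 * p.2.

Definition monomial_order m (le : rel 'X_{1..m}) : Prop :=
  [/\ antisymmetric le, transitive le, total le,
      forall a, le 0%MM a
    & forall a b c : 'X_{1..m}, le a b -> le (a + c)%MM (b + c)%MM].

Definition initial_monomial (K : fieldType) m (le : rel 'X_{1..m})
    (f : {mpoly K[m]}) (a : 'X_{1..m}) : Prop :=
  a \in msupp f /\ forall b, b \in msupp f -> le b a.

(* The ideal generated by the initial monomials of the elements of S; the
   zero polynomial has no initial monomial and contributes nothing. *)
Definition initial_ideal (K : fieldType) m (le : rel 'X_{1..m})
    (S : {mpoly K[m]} -> Prop) : {mpoly K[m]} -> Prop :=
  ideal_span (fun g => exists f a,
    [/\ S f, initial_monomial le f a & g = 'X_[a]]).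

Definition groebner_basis (K : fieldType) m (le : rel 'X_{1..m})
    (I G : {mpoly K[m]} -> Prop) : Prop :=
  [/\ exists s : seq {mpoly K[m]}, forall g, G g -> g \in s,
      forall g, G g -> I g
    & forall f, initial_ideal le G f <-> initial_ideal le I f].

(* Main.v *)
(* Write U_k = u_1 + ... + u_k.  Sorting (u, v) replaces U_k and V_k by the
   upper and lower halves of U_k + V_k, so it yields the only pair with the
   same sum all of whose differences U_k - V_k are 0 or 1.  A strong exchange
   moves a difference outside {0, 1} by two towards it, without touching the
   partial sums on one side of k; settling the differences one after the other
   from that side connects every pair of bases to its sorting by symmetric
   exchanges.
   Sorting strictly lowers a convex weight on the variables, which gives the
   monomial order.  Monomials in pairwise sorted variables are determined by
   their image in K[t]: the largest factor is read off by rounding up the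
   averages of the partial sums, then cancelled.  As every element of the toric
   ideal has two distinct monomials with the same image, its initial monomial
   is never sorted, and binomials with a common image reduce to 0. *)
Require Import Defs.
From mathcomp Require Import all_boot all_order all_algebra.
From mathcomp Require Import finmap.
From mathcomp.multinomials Require Import mpoly.
From mathcomp Require Import zify.

Set Implicit Arguments.
Unset Strict Implicit.
Unset Printing Implicit Defensive.

Import Order.TTheory GRing.Theory.

(** * Partial sums, sorting and exchange *)

Definition psum n (u : 'X_{1..n}) (k : nat) : nat := \sum_(i < n | i < k) u i.

Lemma psum0 n (u : 'X_{1..n}) : psum u 0 = 0.
Proof. by rewrite /psum big1. Qed.

Lemma psumS n (u : 'X_{1..n}) (i : 'I_n) : psum u i.+1 = psum u i + u i.
Proof.
rewrite /psum (bigD1 i) //= addnC; congr (_ + _); apply: eq_bigl => j.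
by rewrite ltnS ltn_neqAle andbC.
Qed.

Lemma psum_ge n (u : 'X_{1..n}) k : n <= k -> psum u k = mdeg u.
Proof.
move=> le_nk; rewrite mdegE; apply: eq_bigl => i.
by rewrite (leq_trans (ltn_ord i) le_nk).
Qed.

Lemma psumD n (u v : 'X_{1..n}) k : psum (u + v)%MM k = psum u k + psum v k.
Proof. by rewrite /psum -big_split; apply: eq_bigr => i _; rewrite mnmDE. Qed.

Lemma psumU n (i : 'I_n) k : psum U_(i)%MM k = (i < k).
Proof.
rewrite /psum big_mkcond (bigD1 i) //= big1 => [|j ne_ji].
  by rewrite mnm1E eqxx; case: ifP.
by rewrite mnm1E eq_sym (negPf ne_ji); case: ifP.
Qed.

Lemma psum_inj n (u v : 'X_{1..n}) : psum u =1 psum v -> u = v.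
Proof.
move=> eq_uv; apply/mnmP => i.
by have := psumS u i; rewrite !eq_uv psumS; lia.
Qed.

(** Turns the suffix sums of [right_strong_exchange] into partial sums: between vectors of equal
    modulus, the smaller suffix sum belongs to the larger partial sum. *)
Lemma psum_suffix n (u : 'X_{1..n}) (i : 'I_n) :
  psum u i.+1 + \sum_(k < n | i < k) u k = mdeg u.
Proof.
rewrite mdegE [RHS](bigID (fun k : 'I_n => k < i.+1)) /=; congr (_ + _).
by apply: eq_bigl => k; rewrite -leqNgt.
Qed.

(** For vectors of equal modulus these are the pairs fixed by sorting; testing [k < n] then
    suffices, since partial sums are constant from [n] on. *)
Definition sorted_pair n (u v : 'X_{1..n}) : bool :=
  [forall k : 'I_n, psum v k <= psum u k <= (psum v k).+1].

Lemma sorted_pairP n (u v : 'X_{1..n}) : mdeg u = mdeg v ->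
  reflect (forall k, psum v k <= psum u k <= (psum v k).+1) (sorted_pair u v).
Proof.
move=> eq_deg; apply: (iffP forallP) => [H k | H k]; last exact: H.
have [lt_kn | le_nk] := ltnP k n; first exact: (H (Ordinal lt_kn)).
by rewrite !psum_ge // eq_deg; lia.
Qed.

(** A property inherited by smaller elements holds on a prefix of a sorted list, and taking every
    other element from the first on keeps the upper half of that prefix. *)
Lemma count_every_other (T : eqType) (r : rel T) (p : pred T) (s : seq T) :
  transitive r -> (forall x y, r x y -> p y -> p x) ->
  sorted r s -> count p (every_other s) = uphalf (count p s).
Proof.
move=> r_tr r_p; elim: {s}(size s).+1 {-2}s (ltnSn (size s)) => // m IH.
case=> [|x [|y s]] //= lt_sm; first by case: (p x).
case/andP => r_xy pth_ys.
rewrite IH ?(path_sorted pth_ys) //; last by move: lt_sm => /=; lia.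
have [p_y | np_y] := boolP (p y); first by rewrite (r_p _ _ r_xy p_y).
have -> : count p s = 0.
  apply/eqP; rewrite eqn0Ngt -has_count; apply/hasPn => z z_s; apply: contra np_y.
  by apply: r_p; move/(order_path_min r_tr)/allP: pth_ys; apply.
by case: (p x).
Qed.

Lemma count_every_other_behead (T : eqType) (r : rel T) (p : pred T)
    (s : seq T) :
  transitive r -> (forall x y, r x y -> p y -> p x) ->
  sorted r s -> count p (every_other (behead s)) = half (count p s).
Proof.
move=> r_tr r_p; case: s => //= x s pth_xs.
rewrite (count_every_other r_tr r_p (path_sorted pth_xs)).
have [p_x | np_x] := boolP (p x) => //=.
rewrite (_ : count p s = 0) //.
apply/eqP; rewrite eqn0Ngt -has_count; apply/hasPn => z z_s; apply: contra np_x.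
by apply: r_p; move/(order_path_min r_tr)/allP: pth_xs; apply.
Qed.

Lemma sorted_mnm_word n (w : 'X_{1..n}) :
  sorted (fun i j : 'I_n => i <= j) (mnm_word w).
Proof.
have le_tr : transitive (fun i j : 'I_n => i <= j).
  by move=> y x z; apply: leq_trans.
have : pairwise (fun i j : 'I_n => i < j) (enum 'I_n).
  rewrite -(pairwise_map val ltn) val_enum_ord.
  by rewrite -(sorted_pairwise ltn_trans) iota_ltn_sorted.
rewrite (sorted_pairwise le_tr) /mnm_word.
elim: (enum 'I_n) => //= i e IH /andP [/allP lt_ie /IH pw_e].
rewrite pairwise_cat pw_e andbT; apply/andP; split.
  apply/allrelP => x y /nseqP [-> _] /flatten_mapP [j j_e /nseqP [-> _]].
  exact: ltnW (lt_ie j j_e).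
by elim: (w i) => //= m ->; rewrite andbT; apply/allP => x /nseqP [->].
Qed.

Lemma count_mnm_word n (w : 'X_{1..n}) (p : pred 'I_n) :
  count p (mnm_word w) = \sum_(i | p i) w i.
Proof.
rewrite /mnm_word count_flatten sumnE 2!big_map big_enum [RHS]big_mkcond /=.
by apply: eq_bigr => i _; rewrite count_nseq; case: (p i); rewrite ?mul1n.
Qed.

Lemma psum_word_mnm n (s : seq 'I_n) k :
  psum (word_mnm s) k = count (fun i : 'I_n => i < k) s.
Proof.
rewrite /psum; elim: s => [|x s IH] /=.
  by rewrite big1 // => i _; rewrite mnmE.
rewrite -IH -psumU /psum -big_split /=; apply: eq_bigr => i _.
by rewrite !mnmE.
Qed.

(** A partial sum counts the letters below [k], which form a prefix of the sorted word; odd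
    positions go to the first vector, even ones to the second. *)
Lemma psum_sort_pair n (u v : 'X_{1..n}) k :
  psum (sort_pair u v).1 k = uphalf (psum u k + psum v k) /\
  psum (sort_pair u v).2 k = half (psum u k + psum v k).
Proof.
have le_tr : transitive (fun i j : 'I_n => i <= j).
  by move=> y x z; apply: leq_trans.
have le_p (i j : 'I_n) : i <= j -> j < k -> i < k by apply: leq_ltn_trans.
have w_sorted := sorted_mnm_word (u + v)%MM.
have -> : psum u k + psum v k = count (fun i : 'I_n => i < k) (mnm_word (u + v)%MM).
  by rewrite -psumD count_mnm_word.
rewrite !psum_word_mnm.
by rewrite (count_every_other le_tr le_p) // (count_every_other_behead le_tr le_p).
Qed.

(** Two numbers with a given sum and difference 0 or 1 are its upper and lower halves, and the
    partial sums determine a vector. *)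
Lemma sort_pairE n (u v u' v' : 'X_{1..n}) : mdeg u' = mdeg v' ->
  sorted_pair u' v' -> (u' + v' = u + v)%MM -> sort_pair u v = (u', v').
Proof.
move=> eq_deg /(sorted_pairP eq_deg) s_uv eq_sum.
have eq_psum k : psum u k + psum v k = psum u' k + psum v' k.
  by rewrite -!psumD eq_sum.
have [p1 p2] := (fun k => (psum_sort_pair u v k).1, fun k => (psum_sort_pair u v k).2).
rewrite [LHS]surjective_pairing; congr (_, _); apply: psum_inj => k;
  rewrite ?p1 ?p2 eq_psum; have := s_uv k; lia.
Qed.

(** * Symmetric exchanges and induction along them *)

(** Written additively to avoid truncated subtraction. *)
Lemma psum_exchange n (u : 'X_{1..n}) (i j : 'I_n) k : 0 < u i ->
  psum (u - U_(i) + U_(j))%MM k + (i < k) = psum u k + (j < k).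
Proof.
move=> u_i; rewrite -!psumU -!psumD; congr (psum _ k).
apply/mnmP => l; rewrite !mnmDE mnmBE mnm1E.
by have [<-|_] := eqVneq i l; lia.
Qed.

Lemma exchangeC n (u : 'X_{1..n}) (i j : 'I_n) : 0 < u j ->
  (u + U_(i) - U_(j) = u - U_(j) + U_(i))%MM.
Proof.
move=> u_j; apply/mnmP => l; rewrite !mnmBE !mnmDE mnmBE !mnm1E.
by have [<-|_] := eqVneq j l; lia.
Qed.

(** The distance of the difference of the partial sums from {0, 1}; at most one of the two truncated
    terms is nonzero. *)
Definition unsortedness n (u v : 'X_{1..n}) k : nat :=
  (psum u k - (psum v k).+1) + (psum v k - psum u k).

(** [Q] is pulled back from the exchanged pair to the original one, so it propagates from sorted
    pairs to every pair that exchanges lead to them. *)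
Definition exchange_stable n (B : {fset 'X_{1..n}})
    (Q : 'X_{1..n} -> 'X_{1..n} -> Prop) : Prop :=
  forall (u v : 'X_{1..n}) (i j : 'I_n), u \in B -> v \in B ->
    v i < u i -> u j < v j ->
    (u - U_(i) + U_(j))%MM \in B -> (v + U_(i) - U_(j))%MM \in B ->
    Q (u - U_(i) + U_(j))%MM (v + U_(i) - U_(j))%MM -> Q u v.

(** Differences are settled from [n] downwards: an exchange at [i = p] with [j < i] alters partial
    sums only for [j < k <= p], so those beyond [p] stay settled. *)
Lemma left_exchange_ind n (B : {fset 'X_{1..n}}) d
    (Q : 'X_{1..n} -> 'X_{1..n} -> Prop) :
  (forall u, u \in B -> mdeg u = d) -> left_strong_exchange B ->
  (forall u v, u \in B -> v \in B -> sorted_pair u v -> Q u v) ->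
  exchange_stable B Q ->
  forall u v, u \in B -> v \in B -> Q u v.
Proof.
move=> degB exB Qsort Qex.
have H p u v : u \in B -> v \in B ->
    (forall k, p <= k -> unsortedness u v k = 0) -> Q u v.
  elim: p u v => [|p IHp] u v.
    move=> uB vB s_uv; apply: Qsort => //; apply/sorted_pairP.
      by rewrite !degB.
    by move=> k; have := s_uv k isT; rewrite /unsortedness; lia.
  have [c le_c] := ubnP (unsortedness u v p).
  elim: c u v le_c => // c IHc u v le_c uB vB s_uv.
  have eq_deg : mdeg u = mdeg v by rewrite !degB.
  have [s_p | ns_p] := eqVneq (unsortedness u v p) 0.
    apply: IHp => // k; rewrite leq_eqVlt => /predU1P [<- //|]; exact: s_uv.
  have lt_pn : p < n.
    rewrite ltnNge; apply: contra ns_p => le_np.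
    by rewrite /unsortedness !psum_ge // eq_deg; lia.
  pose i := Ordinal lt_pn.
  have Su := psumS u i; have Sv := psumS v i.
  (* As the difference at [p.+1] is 0 or 1, a difference outside {0, 1} at [p] decides which of
     [u i] and [v i] is larger. *)
  have := s_uv p.+1 (leqnn _); rewrite /unsortedness => s_p1.
  have [lt_p | ge_p] := ltnP (psum u p) (psum v p).
    have lt_i : v i < u i by move: Su Sv => /=; lia.
    have [j [lt_ji lt_j u1B v1B]] := exB u v i uB vB lt_i lt_p.
    apply: (Qex u v i j) => //.
    have Eu k := psum_exchange j k (leq_ltn_trans (leq0n _) lt_i).
    have Ev k := psum_exchange i k (leq_ltn_trans (leq0n _) lt_j).
    rewrite exchangeC in v1B *; last by lia.
    apply: IHc => //.
      move: (Eu p) (Ev p) le_c lt_ji; rewrite /unsortedness /=.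
      by case: ltnP => //; case: ltnP => //; lia.
    move=> k lt_pk; move: (Eu k) (Ev k) lt_ji (s_uv k lt_pk) => /=.
    rewrite /unsortedness; case: (ltnP p k) => //; case: (ltnP j k) => //; lia.
  move: ns_p; rewrite /unsortedness => ns_p.
  have lt_i : u i < v i by move: Su Sv => /=; lia.
  have lt_p : psum v p < psum u p by lia.
  (* The property is applied to [(v, u)]; seen from [(u, v)] it is an exchange with the roles of [i]
     and [j] swapped. *)
  have [j [lt_ji lt_j v1B u1B]] := exB v u i vB uB lt_i lt_p.
  have Ev k := psum_exchange j k (leq_ltn_trans (leq0n _) lt_i).
  have Eu k := psum_exchange i k (leq_ltn_trans (leq0n _) lt_j).
  have u1B' := u1B; rewrite exchangeC in u1B'; last by lia.
  have v1B' := v1B; rewrite -exchangeC in v1B'; last by lia.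
  apply: (Qex u v j i) => //.
  rewrite exchangeC; last by lia.
  apply: IHc => //.
    move: (Eu p) (Ev p) le_c lt_ji; rewrite /unsortedness /=.
    by case: ltnP => //; case: ltnP => //; lia.
  move=> k lt_pk; move: (Eu k) (Ev k) lt_ji (s_uv k lt_pk) => /=.
  rewrite /unsortedness; case: (ltnP p k) => //; case: (ltnP j k) => //; lia.
move=> u v uB vB; apply: (H n) => // k le_nk.
by rewrite /unsortedness !psum_ge // !degB; lia.
Qed.

(** Differences are settled from 0 upwards: for the one at [p.+1], the exchange at [i = p] with
    [i < j] leaves the partial sums up to [p] alone. *)
Lemma right_exchange_ind n (B : {fset 'X_{1..n}}) d
    (Q : 'X_{1..n} -> 'X_{1..n} -> Prop) :
  (forall u, u \in B -> mdeg u = d) -> right_strong_exchange B ->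
  (forall u v, u \in B -> v \in B -> sorted_pair u v -> Q u v) ->
  exchange_stable B Q ->
  forall u v, u \in B -> v \in B -> Q u v.
Proof.
move=> degB exB Qsort Qex.
(* [m] counts the indices from [p] to [n], which remain to be settled. *)
have H m p u v : p + m = n.+1 -> u \in B -> v \in B ->
    (forall k, k < p -> unsortedness u v k = 0) -> Q u v.
  elim: m p u v => [|m IHm] p u v.
    rewrite addn0 => -> uB vB s_uv; apply: Qsort => //.
    apply/forallP => k; have := s_uv k (leqW (ltn_ord k)).
    by rewrite /unsortedness; lia.
  move=> eq_pm.
  have [c le_c] := ubnP (unsortedness u v p).
  elim: c u v le_c => // c IHc u v le_c uB vB s_uv.
  have eq_deg : mdeg u = mdeg v by rewrite !degB.
  have [s_p | ns_p] := eqVneq (unsortedness u v p) 0.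
    apply: (IHm p.+1) => //; first by lia.
    by move=> k; rewrite ltnS leq_eqVlt => /predU1P [-> //|]; exact: s_uv.
  case: p eq_pm le_c s_uv ns_p IHc => [|p] eq_pm le_c s_uv ns_p IHc.
    by move: ns_p; rewrite /unsortedness !psum0.
  have lt_pn : p < n by lia.
  pose i := Ordinal lt_pn.
  have Su := psumS u i; have Sv := psumS v i.
  have Du := psum_suffix u i; have Dv := psum_suffix v i.
  have := s_uv p (leqnn _); rewrite /unsortedness => s_p1.
  move: ns_p; rewrite {1}/unsortedness => ns_p.
  have [lt_p | ge_p] := ltnP (psum v p.+1) (psum u p.+1).
    have lt_i : v i < u i by move: Su Sv => /=; lia.
    have [|j [lt_ij lt_j u1B v1B]] := exB u v i uB vB lt_i.
      by move: Du Dv => /=; lia.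
    apply: (Qex u v i j) => //.
    have Eu k := psum_exchange j k (leq_ltn_trans (leq0n _) lt_i).
    have Ev k := psum_exchange i k (leq_ltn_trans (leq0n _) lt_j).
    rewrite exchangeC in v1B *; last by lia.
    apply: IHc => //.
      move: (Eu p.+1) (Ev p.+1) le_c lt_ij; rewrite /unsortedness /=.
      by case: ltnP => //; case: ltnP => //; lia.
    move=> k lt_pk; move: (Eu k) (Ev k) lt_ij (s_uv k lt_pk) => /=.
    rewrite /unsortedness; case: (ltnP p k) => //; case: (ltnP j k) => //; lia.
  have lt_i : u i < v i by move: Su Sv => /=; lia.
  have [|j [lt_ij lt_j v1B u1B]] := exB v u i vB uB lt_i.
    by move: Du Dv => /=; lia.
  have Ev k := psum_exchange j k (leq_ltn_trans (leq0n _) lt_i).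
  have Eu k := psum_exchange i k (leq_ltn_trans (leq0n _) lt_j).
  have u1B' := u1B; rewrite exchangeC in u1B'; last by lia.
  have v1B' := v1B; rewrite -exchangeC in v1B'; last by lia.
  apply: (Qex u v j i) => //.
  rewrite exchangeC; last by lia.
  apply: IHc => //.
    move: (Eu p.+1) (Ev p.+1) le_c lt_ij; rewrite /unsortedness /=.
    by case: ltnP => //; case: ltnP => //; lia.
  move=> k lt_pk; move: (Eu k) (Ev k) lt_ij (s_uv k lt_pk) => /=.
  rewrite /unsortedness; case: (ltnP p k) => //; case: (ltnP j k) => //; lia.
by move=> u v uB vB; apply: (H n.+1 0).
Qed.

(** * Weights and sorted monomials *)

Definition psum_square n (u : 'X_{1..n}) : nat := \sum_(k < n) psum u k ^ 2.
Definition psum_total n (u : 'X_{1..n}) : nat := \sum_(k < n) psum u k.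

Lemma psum_total_le n (u : 'X_{1..n}) : psum_total u <= n * mdeg u.
Proof.
rewrite -[n in n * _]card_ord -sum_nat_const; apply: leq_sum => k _.
by rewrite mdegE [X in _ <= X](bigID (fun i : 'I_n => i < k)) leq_addr.
Qed.

(** Twice the sum of the squares is the square of the sum plus the square of the difference, so for
    a fixed sum it is least when the difference is at most 1. *)
Lemma balanced_sum_squares a b a' b' : a + b = a' + b' -> b' <= a' <= b'.+1 ->
  a' ^ 2 + b' ^ 2 <= a ^ 2 + b ^ 2 ?= iff (a <= b.+1) && (b <= a.+1).
Proof.
move=> eq_ab bal; case: (leqP a' a) => [/subnKC | lt_aa].
  move: (a - a') => x def_a; have {eq_ab} def_b' : b' = b + x by lia.
  rewrite -def_a def_b' in bal *; apply/leqifP; case: ifPn; last by nia.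
  by move=> H; apply/eqP; have -> : x = 0; [lia | rewrite !addn0].
have le_ab : a <= b' by lia.
move/subnKC: le_ab; move: (b' - a) => x def_b'; have {eq_ab} def_b : b = a' + x by lia.
rewrite -def_b' def_b in bal *; apply/leqifP; case: ifPn; last by nia.
by move=> H; apply/eqP; have -> : x = 0; [lia | rewrite !addn0 addnC].
Qed.

(* Sorting an unsorted pair lowers the sum of the squares of the partial sums;
   when all differences of partial sums are in {-1, 0, 1} that sum is unchanged,
   but the square of the total of the partial sums goes up.  The last subtraction
   is not truncated, by [psum_total_le]. *)
Definition sort_weight n (u : 'X_{1..n}) : nat :=
  (2 * (n * mdeg u) ^ 2 + 1) * psum_square u +
  ((n * mdeg u) ^ 2 - psum_total u ^ 2).

Lemma sort_weight_lt n (u v u' v' : 'X_{1..n}) :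
  mdeg u = mdeg v -> mdeg u = mdeg u' -> mdeg u = mdeg v' ->
  (u' + v' = u + v)%MM -> sorted_pair u' v' ->
  ~~ sorted_pair u v -> ~~ sorted_pair v u ->
  sort_weight u' + sort_weight v' < sort_weight u + sort_weight v.
Proof.
move=> dv du' dv' eq_sum s_uv' ns_uv ns_vu.
have eq_psum k : psum u k + psum v k = psum u' k + psum v' k.
  by rewrite -!psumD eq_sum.
have {}s_uv' (k : 'I_n) := forallP s_uv' k.
have eqT : psum_total u + psum_total v = psum_total u' + psum_total v'.
  by rewrite /psum_total -!big_split; apply: eq_bigr => k _; apply: eq_psum.
have sq2 (k : 'I_n) := balanced_sum_squares (eq_psum k) (s_uv' k).
have le2 (k : 'I_n) := (sq2 k).1.
have le2S : psum_square u' + psum_square v' <= psum_square u + psum_square v.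
  by rewrite /psum_square -!big_split; apply: leq_sum => k _; apply: le2.
have Lu := psum_total_le u; have Lv := psum_total_le v.
have Lu' := psum_total_le u'; have Lv' := psum_total_le v'.
rewrite /sort_weight -!dv -!du' -!dv' in Lv Lu' Lv' *.
set N := n * mdeg u in Lu Lv Lu' Lv' *.
have sqr x : x <= N -> x ^ 2 <= N ^ 2 by move=> le_xN; rewrite leq_exp2r.
move: (sqr _ Lu) (sqr _ Lv) (sqr _ Lu') (sqr _ Lv').
(* If some sum of squares drops, the factor [2 * N ^ 2 + 1] outweighs the two correction terms, each
   at most [N ^ 2]. *)
have [/existsP [k lt2] | /existsPn le1] := boolP [exists k : 'I_n,
    psum u' k ^ 2 + psum v' k ^ 2 < psum u k ^ 2 + psum v k ^ 2].
  have : psum_square u' + psum_square v' < psum_square u + psum_square v.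
    rewrite /psum_square -!big_split /= (bigD1 k) //= [X in _ < X](bigD1 k) //=.
    by rewrite -addSn leq_add //; apply: leq_sum => l _; apply: le2.
  clear; set N2 := N ^ 2; move: N2 => N2; nia.
have D1 (k : 'I_n) : psum u k <= (psum v k).+1 /\ psum v k <= (psum u k).+1.
  by have := le1 k; rewrite (ltn_leqif (sq2 k)) negbK => /andP.
(* All differences are now at most 1 in absolute value, so [u'] carries the pointwise maxima of the
   partial sums. *)
have le_max (k : 'I_n) : psum u k <= psum u' k /\ psum v k <= psum u' k.
  by have := D1 k; have := s_uv' k; have := eq_psum k; lia.
have lt_total (x y : 'X_{1..n}) : (forall k : 'I_n, psum x k <= psum y k) ->
    (exists k : 'I_n, psum x k < psum y k) -> psum_total x < psum_total y.
  move=> le_xy [k lt_xy]; rewrite /psum_total (bigD1 k) //=.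
  rewrite [X in _ < X](bigD1 k) //= -addSn leq_add //.
  by apply: leq_sum => l _; apply: le_xy.
(* Being unsorted now means that [v] exceeds [u] at some [k], where [u'] therefore exceeds [u];
   likewise for [v] below. *)
have ltu : psum_total u < psum_total u'.
  apply: lt_total => [k|]; first exact: (le_max k).1.
  have /forallPn [k ns_k] := ns_uv; exists k.
  by have := D1 k; have := s_uv' k; have := eq_psum k; lia.
have ltv : psum_total v < psum_total u'.
  apply: lt_total => [k|]; first exact: (le_max k).2.
  have /forallPn [k ns_k] := ns_vu; exists k.
  by have := D1 k; have := s_uv' k; have := eq_psum k; lia.
(* The totals keep their sum but move further apart, so the sum of their squares grows. *)
have : psum_total u ^ 2 + psum_total v ^ 2 < psum_total u' ^ 2 + psum_total v' ^ 2.
  by clear -eqT ltu ltv; nia.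
clear -le2S; set N2 := N ^ 2; move: N2 => N2; nia.
Qed.

(** * Images of monomials and sorted monomials *)

(** The exponent of the image of ['X_[a]] when each variable ['X_i] is sent to ['X_[pt i]]. *)
Definition mnm_image m n (pt : 'I_m -> 'X_{1..n}) (a : 'X_{1..m}) : 'X_{1..n} :=
  (\sum_i pt i *+ a i)%MM.

Lemma mnm_imageD m n (pt : 'I_m -> 'X_{1..n}) a b :
  mnm_image pt (a + b)%MM = (mnm_image pt a + mnm_image pt b)%MM.
Proof.
rewrite /mnm_image -big_split /=; apply: eq_bigr => i _; rewrite mnmDE.
by apply/mnmP => j; rewrite mnmDE !mulmnE mulnDr.
Qed.

Lemma mnm_imageU m n (pt : 'I_m -> 'X_{1..n}) i :
  mnm_image pt U_(i)%MM = pt i.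
Proof.
rewrite /mnm_image (bigD1 i) //= mnm1E eqxx big1 ?addm0 // => j ne_ji.
by rewrite mnm1E eq_sym (negPf ne_ji).
Qed.

Lemma psum_image m n (pt : 'I_m -> 'X_{1..n}) a k :
  psum (mnm_image pt a) k = \sum_i a i * psum (pt i) k.
Proof.
rewrite /psum (eq_bigr (fun j => \sum_i (pt i *+ a i)%MM j)) => [|j _]; last exact: mnm_sumE.
rewrite exchange_big; apply: eq_bigr => i _.
by rewrite big_distrr; apply: eq_bigr => j _; rewrite mulmnE mulnC.
Qed.

Lemma mdeg_image m n (pt : 'I_m -> 'X_{1..n}) d a :
  (forall i, mdeg (pt i) = d) -> mdeg (mnm_image pt a) = mdeg a * d.
Proof.
move=> deg_pt; rewrite /mnm_image mdeg_sum mdegE big_distrl.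
by apply: eq_bigr => i _; rewrite mdegMn deg_pt mulnC.
Qed.

Definition sorted_mnm m n (pt : 'I_m -> 'X_{1..n}) (a : 'X_{1..m}) : bool :=
  [forall i, forall j, (0 < a i) && (0 < a j) ==>
     (sorted_pair (pt i) (pt j) || sorted_pair (pt j) (pt i))].

Lemma sorted_mnmP m n (pt : 'I_m -> 'X_{1..n}) (a : 'X_{1..m}) :
  reflect (forall i j, 0 < a i -> 0 < a j ->
             sorted_pair (pt i) (pt j) || sorted_pair (pt j) (pt i))
          (sorted_mnm pt a).
Proof.
apply: (iffP forallP) => [H i j ai aj | H i].
  by have /forallP /(_ j) := H i; rewrite ai aj.
by apply/forallP => j; apply/implyP => /andP [ai aj]; apply: H.
Qed.

(** A factor with the largest total of partial sums works: any factor dominating it pointwise must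
    have the same partial sums. *)
Lemma sorted_mnm_max m n (pt : 'I_m -> 'X_{1..n}) (a : 'X_{1..m}) :
  a != 0%MM -> sorted_mnm pt a ->
  exists2 i, 0 < a i & forall j, 0 < a j -> sorted_pair (pt i) (pt j).
Proof.
move=> a_neq0 /sorted_mnmP s_a.
have [i0 ai0] : exists i, 0 < a i.
  apply/existsP; apply: contraR a_neq0 => /existsPn a0.
  by apply/eqP/mnmP => i; rewrite mnm0E; have := a0 i; lia.
case: (@arg_maxnP _ i0 (fun i => 0 < a i) (fun i => psum_total (pt i)) ai0).
move=> i ai max_i; exists i => // j aj.
have /orP [//|s_ji] := s_a i j ai aj.
have le_ij (k : 'I_n) : psum (pt i) k <= psum (pt j) k.
  by have /andP [] := forallP s_ji k.
have : psum_total (pt j) <= psum_total (pt i) := max_i j aj.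
rewrite /psum_total leqNgt => nlt.
apply/forallP => k.
have -> : psum (pt i) k = psum (pt j) k; last by rewrite leqnn leqnSn.
apply/eqP; rewrite eqn_leq le_ij leqNgt; apply: contra nlt => lt_k.
rewrite (bigD1 k) //= [X in _ < X](bigD1 k) //= -addSn leq_add //.
by apply: leq_sum => l _.
Qed.

(* The partial sums of the largest factor are the rounded-up averages of the
   partial sums of all factors. *)
Lemma psum_max_mnm m n (pt : 'I_m -> 'X_{1..n}) (a : 'X_{1..m}) i k :
  0 < a i ->
  (forall j, 0 < a j -> psum (pt j) k <= psum (pt i) k <= (psum (pt j) k).+1) ->
  psum (mnm_image pt a) k <= mdeg a * psum (pt i) k <
    psum (mnm_image pt a) k + mdeg a.
Proof.
move=> ai max_i; rewrite psum_image mdegE big_distrl -big_split /=.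
apply/andP; split.
  apply: leq_sum => j _; case: (posnP (a j)) => [->|/max_i] //.
  by rewrite leq_mul2l => /andP [-> _]; rewrite orbT.
rewrite (bigD1 i) //= [X in _ < X](bigD1 i) //= -addSn leq_add //.
  by rewrite -addn1 leq_add2l.
apply: leq_sum => j _; case: (posnP (a j)) => [->|/max_i] //.
by case/andP => _; nia.
Qed.

(** By induction on the degree, the largest factor is read off from the image and cancelled on both
    sides. With [d = 0] all powers of a variable would share one image. *)
Lemma sorted_mnm_inj m n (pt : 'I_m -> 'X_{1..n}) d a b :
  0 < d -> (forall i, mdeg (pt i) = d) -> injective pt ->
  sorted_mnm pt a -> sorted_mnm pt b -> mnm_image pt a = mnm_image pt b -> a = b.
Proof.
move=> d_gt0 deg_pt pt_inj.
have [N le_aN] := ubnP (mdeg a); elim: N a b le_aN => // N IH a b le_aN s_a s_b eq_ab.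
have eq_deg : mdeg a = mdeg b.
  have := mdeg_image a deg_pt; rewrite eq_ab (mdeg_image b deg_pt).
  by move/eqP; rewrite eqn_pmul2r // => /eqP.
have [a0 | a_neq0] := eqVneq a 0%MM.
  by apply/esym/eqP; rewrite a0 -mdeg_eq0 -eq_deg a0 mdeg0.
have b_neq0 : b != 0%MM by rewrite -mdeg_eq0 -eq_deg mdeg_eq0.
have [i ai max_i] := sorted_mnm_max a_neq0 s_a.
have [i' bi' max_i'] := sorted_mnm_max b_neq0 s_b.
have eq_d j l : mdeg (pt j) = mdeg (pt l) by rewrite !deg_pt.
(* The partial sums of both largest factors are the same quotient, image over degree, rounded up. *)
have eq_ii' : i = i'.
  apply/pt_inj/psum_inj => k.
  have := psum_max_mnm ai (fun j aj => sorted_pairP (eq_d _ _) (max_i j aj) k).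
  have := psum_max_mnm bi' (fun j aj => sorted_pairP (eq_d _ _) (max_i' j aj) k).
  by rewrite eq_ab eq_deg; nia.
rewrite -{i' max_i'}eq_ii' in bi'.
have splitU (c : 'X_{1..m}) : 0 < c i -> c = (c - U_(i) + U_(i))%MM.
  by move=> ci; rewrite submK // lep1mP -lt0n.
have subS (c : 'X_{1..m}) : sorted_mnm pt c -> sorted_mnm pt (c - U_(i))%MM.
  move=> /sorted_mnmP s_c; apply/sorted_mnmP => j l.
  by rewrite !mnmBE => cj cl; apply: s_c; lia.
rewrite (splitU a ai) (splitU b bi'); congr (_ + _)%MM.
apply: IH; rewrite ?subS //.
  by move: le_aN; rewrite {1}(splitU a ai) mdegD mdeg1; lia.
move: eq_ab; rewrite {1}(splitU a ai) {1}(splitU b bi') !mnm_imageD.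
by rewrite ![(_ + mnm_image pt U_(i))%MM]addmC => /addmI.
Qed.

(** * Weight orders *)

Definition weight_degree m (w : 'I_m -> nat) (a : 'X_{1..m}) : nat :=
  \sum_i a i * w i.

Lemma weight_degreeD m (w : 'I_m -> nat) a b :
  weight_degree w (a + b)%MM = weight_degree w a + weight_degree w b.
Proof.
by rewrite -big_split; apply: eq_bigr => i _; rewrite mnmDE mulnDl.
Qed.

Lemma weight_degreeU m (w : 'I_m -> nat) i : weight_degree w U_(i)%MM = w i.
Proof.
rewrite /weight_degree (bigD1 i) //= mnm1E eqxx mul1n big1 ?addn0 // => j ne_ji.
by rewrite mnm1E eq_sym (negPf ne_ji).
Qed.

(** Ties are broken by the order [<=%O] on multinomials, itself total, compatible with addition and
    with least element 0. *)
Definition weight_order m (w : 'I_m -> nat) : rel 'X_{1..m} := fun a b =>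
  (weight_degree w a < weight_degree w b) ||
  ((weight_degree w a == weight_degree w b) && (a <= b)%O).

Lemma weight_order_monomial m (w : 'I_m -> nat) : monomial_order (weight_order w).
Proof.
split.
- by move=> a b; rewrite /weight_order; case: ltngtP => //= _ /le_anti.
- move=> b a c; rewrite /weight_order.
  case/orP => [lt_ab | /andP [/eqP -> le_ab]]; last first.
    by case/orP => [-> // | /andP [-> /(le_trans le_ab) ->]]; rewrite orbT.
  by case/orP => [lt_bc | /andP [/eqP <- _]]; rewrite ?lt_ab // (ltn_trans lt_ab).
- by move=> a b; rewrite /weight_order; case: ltngtP => //= _; apply: le_total.
- move=> a; rewrite /weight_order le0m andbT orbC -leq_eqVlt.
  by rewrite {1}/weight_degree big1 // => i _; rewrite mnm0E.
- move=> a b c; rewrite /weight_order !weight_degreeD ltn_add2r eqn_add2r.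
  by case/orP => [-> // | /andP [-> le_ab]]; rewrite lem_add // orbT.
Qed.

(** * Kernels of monomial maps *)

Lemma ideal_span_mem (A : comNzRingType) (S : A -> Prop) f : S f -> ideal_span S f.
Proof.
move=> Sf; exists [:: (1%R, f)]; split; last by rewrite big_seq1 mul1r.
by move=> p /[1!inE] /eqP ->.
Qed.

Lemma ideal_span0 (A : comNzRingType) (S : A -> Prop) : ideal_span S 0%R.
Proof. by exists [::]; rewrite big_nil. Qed.

Lemma ideal_spanD (A : comNzRingType) (S : A -> Prop) f g :
  ideal_span S f -> ideal_span S g -> ideal_span S (f + g)%R.
Proof.
move=> [s [Ss ->]] [t [St ->]]; exists (s ++ t); rewrite big_cat; split=> // p.
by rewrite mem_cat => /orP [/Ss | /St].
Qed.

Lemma ideal_spanM (A : comNzRingType) (S : A -> Prop) c f :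
  ideal_span S f -> ideal_span S (c * f)%R.
Proof.
move=> [s [Ss ->]]; exists [seq ((c * p.1)%R, p.2) | p <- s]; split.
  by move=> p /mapP [q /Ss Sq ->].
by rewrite big_map mulr_sumr; apply: eq_bigr => p _; rewrite mulrA.
Qed.

Lemma ideal_spanN (A : comNzRingType) (S : A -> Prop) f :
  ideal_span S f -> ideal_span S (- f)%R.
Proof. by rewrite -mulN1r; apply: ideal_spanM. Qed.

Lemma ideal_span_incl (A : comNzRingType) (S T : A -> Prop) f :
  (forall g, S g -> ideal_span T g) -> ideal_span S f -> ideal_span T f.
Proof.
move=> ST [s [Ss ->]]; elim: s Ss => [|p s IH] Ss.
  by rewrite big_nil; apply: ideal_span0.
rewrite big_cons; apply: ideal_spanD.
  by apply/ideal_spanM/ST/Ss; rewrite inE eqxx.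
by apply: IH => q q_s; apply: Ss; rewrite inE q_s orbT.
Qed.

(** For [pt := base_point] this is [toric_map] up to conversion. *)
Definition monomial_map (K : fieldType) m n (pt : 'I_m -> 'X_{1..n})
    (f : {mpoly K[m]}) : {mpoly K[n]} := (f \mPo [tuple 'X_[pt i] | i < m])%R.

Lemma monomial_mapX (K : fieldType) m n (pt : 'I_m -> 'X_{1..n}) a :
  monomial_map pt 'X_[K, a] = 'X_[mnm_image pt a]%R.
Proof.
rewrite /monomial_map comp_mpolyX /mnm_image.
rewrite (big_morph (fun b => 'X_[K, b]%R) (@mpolyXD _ _) (@mpolyX0 _ _)).
by apply: eq_bigr => i _; rewrite tnth_mktuple mpolyXn.
Qed.

Lemma monomial_mapE (K : fieldType) m n (pt : 'I_m -> 'X_{1..n}) f :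
  monomial_map pt f =
  (\sum_(a <- msupp f) f@_a *: 'X_[K, mnm_image pt a])%R.
Proof.
rewrite /monomial_map comp_mpolyEX; apply: eq_bigr => a _.
by rewrite -monomial_mapX.
Qed.

(** If no other monomial shared the image of [a], the coefficient of that image would be the nonzero
    [f@_a]. *)
Lemma monomial_map0_other (K : fieldType) m n (pt : 'I_m -> 'X_{1..n})
    (f : {mpoly K[m]}) a :
  monomial_map pt f = 0%R -> a \in msupp f ->
  exists b, [/\ b \in msupp f, b != a & mnm_image pt b = mnm_image pt a].
Proof.
move=> f0 a_f.
suff /hasP [b b_f /andP [ne_ba /eqP]] :
  has (fun b => (b != a) && (mnm_image pt b == mnm_image pt a)) (msupp f).
  by exists b.
apply/contraT => /hasPn no_b; move: (a_f); rewrite mcoeff_msupp => /negP [].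
have : mcoeff (mnm_image pt a) (monomial_map pt f) = 0%R by rewrite f0 mcoeff0.
rewrite monomial_mapE raddf_sum (bigD1_seq a) //= mcoeffZ mcoeffX eqxx mulr1.
rewrite big1_seq ?addr0 => [-> //|b /andP [ne_ba /no_b]].
by rewrite ne_ba mcoeffZ mcoeffX /= => /negPf ->; rewrite mulr0.
Qed.

(** Subtracting a multiple of a binomial with a common image removes one monomial from the support,
    so induction on its size applies. *)
Lemma ideal_span_monomial_map0 (K : fieldType) m n (pt : 'I_m -> 'X_{1..n})
    (S : {mpoly K[m]} -> Prop) f :
  (forall a b, mnm_image pt a = mnm_image pt b ->
     ideal_span S ('X_[a] - 'X_[b])%R) ->
  monomial_map pt f = 0%R -> ideal_span S f.
Proof.
move=> Sab; have [N le_fN] := ubnP (size (msupp f)).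
elim: N f le_fN => // N IH f le_fN f0.
have [-> | f_neq0] := eqVneq f 0%R; first exact: ideal_span0.
have /hasP [a a_f _] : has predT (msupp f).
  by rewrite has_predT lt0n size_eq0 msupp_eq0.
have [b [b_f ne_ba eq_ba]] := monomial_map0_other f0 a_f.
pose c := (f@_b *: ('X_[b] - 'X_[a]) : {mpoly K[m]})%R.
have Sc : ideal_span S c.
  by rewrite /c -mul_mpolyC; apply/ideal_spanM/Sab.
rewrite -(subrK c f); apply: ideal_spanD => //; apply: IH; last first.
  have c0 : monomial_map pt c = 0%R.
    by rewrite /monomial_map linearZ linearB /= -!/(monomial_map _ _) !monomial_mapX
               eq_ba subrr scaler0.
  by rewrite /monomial_map linearB /= -!/(monomial_map _ _) f0 c0 subrr.
rewrite -ltnS; apply: leq_ltn_trans le_fN.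
have c_b : ((f - c)@_b = 0)%R.
  by rewrite mcoeffB mcoeffZ mcoeffB !mcoeffX eqxx eq_sym (negPf ne_ba) subr0 mulr1 subrr.
(* [b] leaves the support and nothing enters it, as [a] was there already. *)
apply: (@uniq_leq_size _ (b :: msupp (f - c)%R)).
  by rewrite /= msupp_uniq andbT mcoeff_msupp c_b eqxx.
move=> e; rewrite inE => /predU1P [-> //|]; rewrite !mcoeff_msupp.
apply: contra => /eqP f_e; rewrite mcoeffB mcoeffZ mcoeffB !mcoeffX f_e.
have [eq_be | _] := eqVneq b e; first by move: b_f; rewrite eq_be mcoeff_msupp f_e eqxx.
have [eq_ae | _] := eqVneq a e; first by move: a_f; rewrite eq_ae mcoeff_msupp f_e eqxx.
by rewrite !mulr0n !subr0 mulr0 subr0.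
Qed.

(** * Reduction to sorted monomials *)

Lemma unsorted_mnm_split m n (pt : 'I_m -> 'X_{1..n}) a : ~~ sorted_mnm pt a ->
  exists i j b, [/\ a = (U_(i) + U_(j) + b)%MM,
    ~~ sorted_pair (pt i) (pt j) & ~~ sorted_pair (pt j) (pt i)].
Proof.
move=> /forallPn [i /forallPn [j]].
rewrite negb_imply => /andP [/andP [ai aj] /norP [ns_ij ns_ji]].
have ne_ij : i != j.
  by apply: contraNneq ns_ij => <-; apply/forallP => k; rewrite leqnn leqnSn.
exists i, j, (a - (U_(i) + U_(j)))%MM; split=> //.
rewrite addmC submK //; apply/mnm_lepP => l; rewrite mnmDE !mnm1E.
have [<-|_] := eqVneq i l; last by case: eqVneq => [<-|].
by rewrite eq_sym (negPf ne_ij).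
Qed.

(** Replacing an unsorted pair of factors lowers the weight, so the rewriting ends. [S] is kept
    general to serve both sorting and exchange relations. *)
Lemma sorted_mnm_exists (K : fieldType) m n (pt : 'I_m -> 'X_{1..n})
    (w : 'I_m -> nat) (S : {mpoly K[m]} -> Prop) a :
  (forall i j, ~~ sorted_pair (pt i) (pt j) -> ~~ sorted_pair (pt j) (pt i) ->
     exists i' j', [/\ w i' + w j' < w i + w j, (pt i' + pt j' = pt i + pt j)%MM
       & ideal_span S ('X_i * 'X_j - 'X_i' * 'X_j')%R]) ->
  exists c, [/\ sorted_mnm pt c, mnm_image pt c = mnm_image pt a,
    c = a \/ weight_degree w c < weight_degree w a
    & ideal_span S ('X_[a] - 'X_[c])%R].
Proof.
move=> red; have [N le_aN] := ubnP (weight_degree w a).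
elim: N a le_aN => // N IH a le_aN.
have [s_a | ns_a] := boolP (sorted_mnm pt a).
  by exists a; split=> //; [left | rewrite subrr; apply: ideal_span0].
have [i [j [b [def_a ns_ij ns_ji]]]] := unsorted_mnm_split ns_a.
have [i' [j' [lt_w eq_pt S_ij]]] := red i j ns_ij ns_ji.
pose a' := (U_(i') + U_(j') + b)%MM.
have lt_a'a : weight_degree w a' < weight_degree w a.
  by rewrite def_a !weight_degreeD !weight_degreeU ltn_add2r.
have [|c [s_c im_c w_c S_c]] := IH a'; first exact: leq_trans lt_a'a _.
exists c; split=> //.
- by rewrite im_c def_a !mnm_imageD !mnm_imageU eq_pt.
- by right; case: w_c => [->|/ltn_trans] //; apply.
rewrite -(subrK 'X_[a'] 'X_[a])%R -addrA; apply: ideal_spanD => //.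
rewrite def_a !mpolyXD -mulrBl mulrC; exact: ideal_spanM.
Qed.

Lemma groebner_basis_sorted (K : fieldType) m n (pt : 'I_m -> 'X_{1..n})
    (w : 'I_m -> nat) (S : {mpoly K[m]} -> Prop) d :
  0 < d -> (forall i, mdeg (pt i) = d) -> injective pt ->
  (exists s : seq {mpoly K[m]}, forall g, S g -> g \in s) ->
  (forall g, S g -> monomial_map pt g = 0%R) ->
  (forall i j, ~~ sorted_pair (pt i) (pt j) -> ~~ sorted_pair (pt j) (pt i) ->
     exists i' j', [/\ w i' + w j' < w i + w j, (pt i' + pt j' = pt i + pt j)%MM
       & S ('X_i * 'X_j - 'X_i' * 'X_j')%R]) ->
  groebner_basis (weight_order w) (fun f => monomial_map pt f = 0%R) S.
Proof.
move=> d_gt0 deg_pt pt_inj fin_S S_ker red; split=> // f.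
split; apply: ideal_span_incl => g [h [a [h_in a_h ->]]].
  by apply: ideal_span_mem; exists h, a; split=> //; apply: S_ker.
(* A sorted initial monomial is impossible: another monomial [b] of [h] with the same image would
   reduce to [a], hence be heavier. *)
have [s_a | ns_a] := boolP (sorted_mnm pt a).
  have [a_supp max_a] := a_h.
  have [b [b_h ne_ba im_b]] := monomial_map0_other h_in a_supp.
  have [|c [s_c im_c w_c _]] := @sorted_mnm_exists K m n pt w S b.
    move=> i j ns_ij ns_ji; have [i' [j' [? ? ?]]] := red i j ns_ij ns_ji.
    by exists i', j'; split=> //; apply: ideal_span_mem.
  have eq_ca : c = a by apply: (sorted_mnm_inj d_gt0 deg_pt) => //; rewrite im_c.
  case: w_c => [eq_cb | lt_cb]; first by rewrite -eq_cb eq_ca eqxx in ne_ba.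
  by have := max_a b b_h; rewrite /weight_order -eq_ca; lia.
(* An unsorted one is a multiple of some ['X_i * 'X_j], which is initial in a relation of [S]
   because it is the heavier term. *)
have [i [j [b [-> ns_ij ns_ji]]]] := unsorted_mnm_split ns_a.
have [i' [j' [lt_w eq_pt S_ij]]] := red i j ns_ij ns_ji.
rewrite addmC mpolyXD; apply/ideal_spanM/ideal_span_mem.
exists ('X_i * 'X_j - 'X_i' * 'X_j')%R, (U_(i) + U_(j))%MM; split=> //.
have lt_ij : weight_degree w (U_(i') + U_(j'))%MM < weight_degree w (U_(i) + U_(j))%MM.
  by rewrite !weight_degreeD !weight_degreeU.
rewrite -!mpolyXD; split.
  rewrite mcoeff_msupp mcoeffB !mcoeffX eqxx.
  have /negPf -> : (U_(i') + U_(j'))%MM != (U_(i) + U_(j))%MM.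
    by apply: contraTneq lt_ij => ->; rewrite ltnn.
  by rewrite subr0 oner_eq0.
move=> c /msuppB_le; rewrite mem_cat !msuppX !inE.
case/orP => /eqP ->; last by rewrite /weight_order lt_ij.
by rewrite /weight_order eqxx lexx orbT.
Qed.

(** * Bases of a discrete polymatroid *)

Lemma basesP n (P : {fset 'X_{1..n}}) u :
  reflect (u \in P /\ forall v, v \in P -> (u <= v)%MM -> v = u) (u \in bases P).
Proof.
rewrite /bases !inE /=; apply: (iffP andP) => [[uP /forallP max_u] | [uP max_u]].
  split=> // v vP le_uv.
  by have /implyP /(_ le_uv) /eqP := max_u [` vP]%fset.
by split=> //; apply/forallP => v; apply/implyP => /(max_u _ (valP v)) ->.
Qed.

(** A basis of smaller modulus could be augmented, against its maximality. *)
Lemma mdeg_bases n (P : {fset 'X_{1..n}}) u v :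
  discrete_polymatroid P -> u \in bases P -> v \in bases P -> mdeg u = mdeg v.
Proof.
move=> [_ _ augment].
have le_deg x y : x \in bases P -> y \in bases P -> mdeg y <= mdeg x.
  move=> /basesP [xP max_x] /basesP [yP _]; rewrite leqNgt; apply/negP => lt_xy.
  have [i [_ xiP]] := augment x y xP yP lt_xy.
  have := max_x _ xiP (lem_addr _ _) => /(congr1 mdeg).
  by rewrite mdegD mdeg1; lia.
by move=> uB vB; apply/eqP; rewrite eqn_leq !le_deg.
Qed.

Lemma bases_rank n (P : {fset 'X_{1..n}}) :
  discrete_polymatroid P -> P != [fset (0%MM : 'X_{1..n})]%fset ->
  exists2 d, 0 < d & forall u, u \in bases P -> mdeg u = d.
Proof.
move=> polyP P_neq0; have [-> | [u uB]] := fset_0Vmem (bases P).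
  (* The degree condition is vacuous here; 1 is a default. *)
  by exists 1 => // u; rewrite inE.
exists (mdeg u) => [|v vB]; last exact: (mdeg_bases polyP).
(* If 0 is maximal, then it is the only element of [P]. *)
rewrite lt0n mdeg_eq0; apply: contraNneq P_neq0 => u0.
have [uP max_u] := basesP _ _ uB; rewrite u0 in uP max_u.
apply/eqP/fsetP => v; rewrite in_fset1; apply/idP/eqP => [vP | -> //].
by apply: max_u => //; apply/mnm_lepP => i; rewrite mnm0E.
Qed.

Lemma exchange_ind n (B : {fset 'X_{1..n}}) d
    (Q : 'X_{1..n} -> 'X_{1..n} -> Prop) :
  (forall u, u \in B -> mdeg u = d) ->
  left_strong_exchange B \/ right_strong_exchange B ->
  (forall u v, u \in B -> v \in B -> sorted_pair u v -> Q u v) ->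
  exchange_stable B Q ->
  forall u v, u \in B -> v \in B -> Q u v.
Proof.
move=> degB [exB | exB]; first exact: left_exchange_ind degB exB.
exact: right_exchange_ind degB exB.
Qed.

Lemma exchange_sum n (u v : 'X_{1..n}) (i j : 'I_n) : 0 < u i -> 0 < v j ->
  (u - U_(i) + U_(j) + (v + U_(i) - U_(j)) = u + v)%MM.
Proof.
move=> ui vj; apply/mnmP => l; rewrite !mnmDE !mnmBE mnmDE !mnm1E.
have le_u : (i == l) <= u l by case: eqVneq => [<-|].
have le_v : (j == l) <= v l by case: eqVneq => [<-|].
lia.
Qed.

Lemma sort_pair_sum n (u v u' v' : 'X_{1..n}) :
  (u + v = u' + v')%MM -> sort_pair u v = sort_pair u' v'.
Proof. by rewrite /sort_pair => ->. Qed.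

Lemma sort_pair_split n (u v : 'X_{1..n}) :
  ((sort_pair u v).1 + (sort_pair u v).2 = u + v)%MM.
Proof.
apply: psum_inj => k; rewrite !psumD.
by have [-> ->] := psum_sort_pair u v k; lia.
Qed.

Lemma sort_pair_sorted n (u v : 'X_{1..n}) :
  sorted_pair (sort_pair u v).1 (sort_pair u v).2.
Proof.
by apply/forallP => k; have [-> ->] := psum_sort_pair u v k; lia.
Qed.

(** Sorting depends only on the sum of the pair, which exchanges preserve, and it fixes sorted
    pairs. *)
Lemma exchange_sortable n (B : {fset 'X_{1..n}}) d :
  (forall u, u \in B -> mdeg u = d) ->
  left_strong_exchange B \/ right_strong_exchange B -> sortable B.
Proof.
move=> degB exB; rewrite /sortable; apply: (exchange_ind degB exB).
  by move=> u v uB vB s_uv; rewrite (@sort_pairE _ u v u v) // !degB.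
move=> u v i j uB vB lt_i lt_j u1B v1B.
by rewrite (@sort_pair_sum _ _ _ u v) // exchange_sum //; lia.
Qed.

(** A sorting relation telescopes along the chain of exchanges from the pair to its sorting, each
    link being an exchange relation. *)
Lemma sorting_relation_span (K : fieldType) n (B : {fset 'X_{1..n}}) d
    (f : base_ring K B) :
  (forall u, u \in B -> mdeg u = d) ->
  left_strong_exchange B \/ right_strong_exchange B ->
  sorting_relation f -> ideal_span (@sym_exchange_relation K n B) f.
Proof.
move=> degB exB.
suff H u v : u \in B -> v \in B -> forall U V U' V' : B,
    val U = u -> val V = v -> sort_pair u v = (val U', val V') ->
    ideal_span (@sym_exchange_relation K n B)
      (xvar K U * xvar K V - xvar K U' * xvar K V')%R.
  move=> [u [v [u' [v' [s_uv ->]]]]]; exact: (H _ _ (valP u) (valP v)).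
move: u v; apply: (exchange_ind degB exB).
  move=> u v uB vB s_uv U V U' V' eU eV.
  rewrite (@sort_pairE _ u v u v) // ?degB // -eU -eV => -[/val_inj <- /val_inj <-].
  rewrite subrr; exact: ideal_span0.
move=> u v i j uB vB lt_i lt_j u1B v1B IH U V U' V' eU eV s_uv.
have s_uv1 : sort_pair (u - U_(i) + U_(j))%MM (v + U_(i) - U_(j))%MM = (val U', val V').
  by rewrite -s_uv; apply: sort_pair_sum; rewrite exchange_sum //; lia.
have := IH [` u1B]%fset [` v1B]%fset U' V' erefl erefl s_uv1.
set x := (_ * _)%R => span_x; rewrite -(subrK x (xvar K U * xvar K V)%R) -addrA.
apply: ideal_spanD => //; apply: ideal_span_mem.
by exists U, V, [` u1B]%fset, [` v1B]%fset, i, j; split; rewrite ?eU ?eV.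
Qed.

(** * The toric ideal of the bases *)

Definition base_point n (B : {fset 'X_{1..n}}) (i : 'I_(#|{: B}|)) : 'X_{1..n} :=
  val (enum_val i : B).

Lemma base_point_rank n (B : {fset 'X_{1..n}}) (u : B) :
  base_point (enum_rank u) = val u.
Proof. by rewrite /base_point enum_rankK. Qed.

Lemma toric_binomial (K : fieldType) n (B : {fset 'X_{1..n}}) (u v u' v' : B) :
  (val u + val v = val u' + val v')%MM ->
  toric_ideal (xvar K u * xvar K v - xvar K u' * xvar K v')%R.
Proof.
move=> eq_sum; rewrite /toric_ideal /xvar -!mpolyXD.
rewrite /toric_map linearB /= -!/(monomial_map (@base_point n B) _).
by rewrite !monomial_mapX !mnm_imageD !mnm_imageU !base_point_rank eq_sum subrr.
Qed.

Lemma toric_ideal_span (K : fieldType) n (B : {fset 'X_{1..n}})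
    (S : base_ring K B -> Prop) f :
  (forall g, S g -> toric_ideal g) -> ideal_span S f -> toric_ideal f.
Proof.
move=> S_toric [s [Ss ->]]; rewrite /toric_ideal /toric_map linear_sum /=.
rewrite big1_seq // => p /= /Ss /S_toric p0.
by rewrite rmorphM /= -[X in (_ * X)%R]/(toric_map p.2) p0 mulr0.
Qed.

Lemma sorting_relation_finite (K : fieldType) n (B : {fset 'X_{1..n}}) :
  exists s : seq (base_ring K B), forall g, sorting_relation g -> g \in s.
Proof.
pose F (x : B * B * (B * B)) : base_ring K B :=
  (xvar K x.1.1 * xvar K x.1.2 - xvar K x.2.1 * xvar K x.2.2)%R.
exists (codom F) => _ [u [v [u' [v' [_ ->]]]]].
exact: (codom_f F (u, v, (u', v'))).
Qed.

Theorem theorem1p2 (n : nat) (K : fieldType) (P : {fset 'X_{1..n}})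
    (P_polymatroid : discrete_polymatroid P)
    (P_rank_pos : P != [fset (0%MM : 'X_{1..n})]%fset)
    (B_exchange : left_strong_exchange (bases P) \/
                  right_strong_exchange (bases P)) :
  (sortable (bases P) /\
   exists le : rel 'X_{1..#|{: bases P}|},
     monomial_order le /\
     groebner_basis le (@toric_ideal K n (bases P))
                       (@sorting_relation K n (bases P))) /\
  (forall f : base_ring K (bases P),
     toric_ideal f <-> ideal_span (@sym_exchange_relation K n (bases P)) f).
Proof.
have [d d_gt0 degB] := bases_rank P_polymatroid P_rank_pos.
move: (bases P) B_exchange degB => B exB degB {P P_polymatroid P_rank_pos}.
have sortB := exchange_sortable degB exB.
pose pt := @base_point n B; pose w i := sort_weight (pt i).
have ptB i : pt i \in B by apply: valP.
have deg_pt i : mdeg (pt i) = d by apply: degB.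
have pt_inj : injective pt by move=> i j /val_inj /enum_val_inj.
(* The rewriting rule behind both claims: an unsorted pair of variables gives way to its sorting, of
   smaller weight. *)
have red i j : ~~ sorted_pair (pt i) (pt j) -> ~~ sorted_pair (pt j) (pt i) ->
    exists i' j', [/\ w i' + w j' < w i + w j, (pt i' + pt j' = pt i + pt j)%MM
      & sorting_relation ('X_i * 'X_j - 'X_i' * 'X_j' : base_ring K B)%R].
  move=> ns_ij ns_ji; have [uB vB] := sortB _ _ (ptB i) (ptB j).
  exists (enum_rank [` uB]%fset), (enum_rank [` vB]%fset).
  have eq_sum := sort_pair_split (pt i) (pt j).
  rewrite /w /pt !base_point_rank /=; split=> //.
    by apply: sort_weight_lt; rewrite ?degB //; apply: sort_pair_sorted.
  exists (enum_val i), (enum_val j), [` uB]%fset, [` vB]%fset.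
  split; first exact: surjective_pairing.
  by rewrite /xvar !enum_valK.
have sorting_toric (g : base_ring K B) : sorting_relation g -> toric_ideal g.
  move=> [u [v [u' [v' [s_uv ->]]]]]; apply: toric_binomial.
  by rewrite -(sort_pair_split (val u)) s_uv.
split.
  split=> //; exists (weight_order w); split; first exact: weight_order_monomial.
  apply: (groebner_basis_sorted d_gt0 deg_pt pt_inj) => //.
  exact: sorting_relation_finite.
move=> f; split; last first.
  apply: toric_ideal_span => _ [u [v [u' [v' [i [j [lt_i lt_j def_u' def_v' ->]]]]]]].
  by apply: toric_binomial; rewrite def_u' def_v' exchange_sum //; lia.
(* It suffices to treat binomials with a common image; both terms reduce to sorted monomials with
   that image, which coincide. *)
apply: (@ideal_span_monomial_map0 _ _ _ pt) => a b eq_ab.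
have red_span i j : ~~ sorted_pair (pt i) (pt j) -> ~~ sorted_pair (pt j) (pt i) ->
    exists i' j', [/\ w i' + w j' < w i + w j, (pt i' + pt j' = pt i + pt j)%MM
      & ideal_span (@sym_exchange_relation K n B) ('X_i * 'X_j - 'X_i' * 'X_j')%R].
  move=> ns_ij ns_ji; have [i' [j' [? ? rel_ij]]] := red i j ns_ij ns_ji.
  by exists i', j'; split=> //; apply: sorting_relation_span degB exB rel_ij.
have [a' [s_a' im_a' _ span_a]] := sorted_mnm_exists a red_span.
have [b' [s_b' im_b' _ span_b]] := sorted_mnm_exists b red_span.
have eq_ab' : a' = b'.
  by apply: (sorted_mnm_inj d_gt0 deg_pt) => //; rewrite im_a' eq_ab im_b'.
rewrite -(subrK 'X_[a'] 'X_[a])%R -addrA {2}eq_ab'; apply: ideal_spanD => //.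
by rewrite -opprB; apply: ideal_spanN.
Qed.
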